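(* Let $T>0$, $h\in(0,T/2]$, $\tau_h=[h,T-h]$, $c\in(0,T)$, $\mu_1,\mu_2,\sigma_1^2,\sigma_2^2>0$ and $n\in\{1,2,\ldots\}$. Let $m^{(n)}$ and $s^{(n)}$ be the functions on $\tau_h$ defined in the context and let $\Lambda^{(n)}=m^{(n)}/s^{(n)}$ (pointwise). Then $\Lambda^{(n)}$ is a continuous function on $\tau_h$ with $\Lambda_t^{(n)}=0$ for $t\in\tau_h\setminus(c-h,c+h]$. If $\mu_1=\mu_2$, then also $\Lambda^{(n)}_t=0$ for $t\in(c-h,c+h]\cap\tau_h$. If $\mu_1\ne\mu_2$, the following holds (all intervals being intersected with $\tau_h$): (i) If $m^{(n)}\ge0$ and $s^{(n)}$ is increasing, then $\Lambda^{(n)}$ is concave and strictly increasing on $[c-h,c]$, and convex and strictly decreasing on $(c,c+h]$. (ii) If $m^{(n)}\ge0$ and $s^{(n)}$ is decreasing, then $\Lambda^{(n)}$ is convex and strictly increasing on $[c-h,c]$, and concave and strictly decreasing on $(c,c+h]$. (iii) If $m^{(n)}\le0$ and $s^{(n)}$ is increasing, then $\Lambda^{(n)}$ is convex and strictly decreasing on $[c-h,c]$, and concave and strictly increasing on $(c,c+h]$. (iv) If $m^{(n)}\le0$ and $s^{(n)}$ is decreasing, then $\Lambda^{(n)}$ is concave and strictly decreasing on $[c-h,c]$, and convex and strictly increasing on $(c,c+h]$. Further, if $\mu_1\neq\mu_2$, then for each $t\in\tau_h$ with $|t-c|<h$, $\Lambda_t^{(n)}$ is of order $(nh)^{1/2}$,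 i.e. $|\Lambda_t^{(n)}|=\Theta((nh)^{1/2})$ as $n\to\infty$.
   Context: For $t\in\tau_h$: $m_t^{(n)}=n(1/\mu_2-1/\mu_1)(h-|t-c|)$ if $|t-c|\le h$ and $m_t^{(n)}=0$ if $|t-c|>h$; $s_t^{(n)}\ge0$ with $$(s_t^{(n)})^2=\begin{cases}2nh\sigma_1^2/\mu_1^3,& t<c-h,\\ n\big((t+h-c)\sigma_2^2/\mu_2^3+(c-(t-h))\sigma_1^2/\mu_1^3\big),&|t-c|\le h,\\ 2nh\sigma_2^2/\mu_2^3,&t>c+h.\end{cases}$$ *)

(* Defs.v *)
From HB Require Import structures.
From mathcomp Require Import all_boot all_order all_algebra.
From mathcomp Require Import all_classical all_reals all_analysis.

Set Implicit Arguments.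
Unset Strict Implicit.
Unset Printing Implicit Defensive.

Import Order.TTheory GRing.Theory Num.Theory.
Import numFieldNormedType.Exports.

Local Open Scope classical_set_scope.
Local Open Scope ring_scope.

Section drift_over_scale.
Variable R : realType.

Definition tau (T h : R) : set R := `[h, T - h].

(* The functions below are total on R: the case distinctions are those given
   for t in tau T h, kept unchanged outside of it. *)

Definition m_fun (h c mu1 mu2 : R) (n : nat) (t : R) : R :=
  if `|t - c| <= h then n%:R * (1 / mu2 - 1 / mu1) * (h - `|t - c|) else 0.

Definition s2_fun (h c mu1 mu2 sigma1 sigma2 : R) (n : nat) (t : R) : R :=
  if t < c - h then 2 * n%:R * h * sigma1 ^+ 2 / mu1 ^+ 3
  else if `|t - c| <= h then
    n%:R * ((t + h - c) * sigma2 ^+ 2 / mu2 ^+ 3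
            + (c - (t - h)) * sigma1 ^+ 2 / mu1 ^+ 3)
  else 2 * n%:R * h * sigma2 ^+ 2 / mu2 ^+ 3.

(* s2_fun is nonnegative when h, mu1, mu2 > 0, so that Num.sqrt is the
   nonnegative s with s ^+ 2 = s2_fun. *)
Definition s_fun (h c mu1 mu2 sigma1 sigma2 : R) (n : nat) (t : R) : R :=
  Num.sqrt (s2_fun h c mu1 mu2 sigma1 sigma2 n t).

Definition Lambda_fun (h c mu1 mu2 sigma1 sigma2 : R) (n : nat) (t : R) : R :=
  m_fun h c mu1 mu2 n t / s_fun h c mu1 mu2 sigma1 sigma2 n t.

(* "Increasing" and "decreasing" without "strictly" are taken in the weak
   sense. *)
Definition increasing_on (D : set R) (f : R -> R) : Prop :=
  {in D &, nondecreasing_fun f}.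

Definition decreasing_on (D : set R) (f : R -> R) : Prop :=
  {in D &, nonincreasing_fun f}.

Definition strictly_increasing_on (D : set R) (f : R -> R) : Prop :=
  {in D &, forall x y, x < y -> f x < f y}.

Definition strictly_decreasing_on (D : set R) (f : R -> R) : Prop :=
  {in D &, forall x y, x < y -> f y < f x}.

Definition convex_on (D : set R) (f : R -> R) : Prop :=
  @convex_function R R^o D f.

Definition concave_on (D : set R) (f : R -> R) : Prop :=
  @convex_function R R^o D (\- f).

End drift_over_scale.

(* Main.v *)
(* On [c - h, c] and on [c, c + h] the ratio m / s is, up to an affine change of
   variable with slope 1 resp. -1, a multiple of u / sqrt (a + d u) with a > 0
   and u >= 0, where d is plus resp. minus the difference of the two
   coefficients sigma^2 / mu^3. That function is strictly increasing in u.
   Writing w = a + d u, one has d u / sqrt w = sqrt w - a / sqrt w, which is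
   concave in w, so the sign of d decides between concavity and convexity.
   The sign of m gives the sign of 1 / mu2 - 1 / mu1 and the monotonicity of s
   gives the sign of the difference of the coefficients, because tau_h always
   meets the interior of [c - h, c + h], in a nondegenerate interval unless
   tau_h is a single point. *)
Require Import Defs.
From HB Require Import structures.
From mathcomp Require Import all_boot all_order all_algebra.
From mathcomp Require Import all_classical all_reals all_analysis.
From mathcomp Require Import ring lra.

Set Implicit Arguments.
Unset Strict Implicit.
Unset Printing Implicit Defensive.

Import Order.TTheory GRing.Theory Num.Theory.
Import numFieldNormedType.Exports.

Local Open Scope classical_set_scope.
Local Open Scope ring_scope.

(** * The model function [u / sqrt (a + d u)]: convexity and monotonicity *)

Section linear_over_sqrt.
Variable R : realType.
Implicit Types (a d u v k l e p x y : R) (D : set R) (f : R -> R).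

Definition linear_over_sqrt a d u : R := u / Num.sqrt (a + d * u).

(** Substitute [d * u = w - a] with [w = a + d * u]. The factor [d] stays on the left because it may
    be zero. *)
Lemma mul_linear_over_sqrt a d u : 0 < a + d * u ->
  d * linear_over_sqrt a d u
    = Num.sqrt (a + d * u) - a / Num.sqrt (a + d * u).
Proof.
move=> w0; rewrite /linear_over_sqrt; set s := Num.sqrt _.
have s0 : 0 < s by rewrite sqrtr_gt0.
have wE : d * u = s ^+ 2 - a by rewrite sqr_sqrtr ?ltW// addrAC subrr add0r.
by rewrite mulrA wE; field; rewrite gt_eqF.
Qed.

(** After squaring, the two sides differ by [l * (1 - l) * (sqrt x - sqrt y) ^+ 2]. *)
Lemma sqrtr_concave x y l : 0 <= x -> 0 <= y -> 0 <= l -> l <= 1 ->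
  l * Num.sqrt x + (1 - l) * Num.sqrt y <= Num.sqrt (l * x + (1 - l) * y).
Proof.
move=> x0 y0 l0 l1; have l1' : 0 <= 1 - l by rewrite subr_ge0.
rewrite -[leLHS]ger0_norm ?addr_ge0 ?mulr_ge0 ?sqrtr_ge0// -sqrtr_sqr.
rewrite ler_sqrt ?addr_ge0 ?mulr_ge0//.
rewrite -[in leRHS](sqr_sqrtr x0) -[in leRHS](sqr_sqrtr y0) -subr_ge0.
set s := Num.sqrt x; set r := Num.sqrt y.
have -> : l * s ^+ 2 + (1 - l) * r ^+ 2 - (l * s + (1 - l) * r) ^+ 2
          = l * (1 - l) * (s - r) ^+ 2 by ring.
by rewrite mulr_ge0 ?sqr_ge0// mulr_ge0.
Qed.

Lemma conv_gt0 x y l : 0 < x -> 0 < y -> 0 <= l -> l <= 1 ->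
  0 < l * x + (1 - l) * y.
Proof.
move=> x0 y0; rewrite le_eqVlt => /orP[/eqP <- _|l0 l1].
  by rewrite mul0r add0r subr0 mul1r.
by rewrite ltr_pwDl ?mulr_gt0// mulr_ge0 ?subr_ge0// ltW.
Qed.

(* Two-point Jensen for [1/z], weakened by the monotonicity of [1/z]. *)
Lemma inv_ge_conv x y z l : 0 < x -> 0 < y -> 0 <= l -> l <= 1 ->
  l * x + (1 - l) * y <= z -> z^-1 <= l / x + (1 - l) / y.
Proof.
move=> x0 y0 l0 l1 xyz; have l1' : 0 <= 1 - l by rewrite subr_ge0.
have c0 : 0 < l * x + (1 - l) * y by exact: conv_gt0.
have z0 := lt_le_trans c0 xyz.
apply: (@le_trans _ _ (l * x + (1 - l) * y)^-1); first by rewrite lef_pV2.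
rewrite -subr_ge0.
have -> : l / x + (1 - l) / y - (l * x + (1 - l) * y)^-1
    = l * (1 - l) * (x - y) ^+ 2 / (x * y * (l * x + (1 - l) * y)).
  by field; rewrite !gt_eqF.
rewrite divr_ge0 ?(ltW (mulr_gt0 _ c0)) ?mulr_gt0//.
by rewrite mulr_ge0 ?sqr_ge0// mulr_ge0.
Qed.

Lemma mul_linear_over_sqrt_concave a d u v l : 0 <= a ->
    0 < a + d * u -> 0 < a + d * v -> 0 <= l -> l <= 1 ->
  d * (l * linear_over_sqrt a d u + (1 - l) * linear_over_sqrt a d v)
    <= d * linear_over_sqrt a d (l * u + (1 - l) * v).
Proof.
move=> a0 wu wv l0 l1; have l1' : 0 <= 1 - l by rewrite subr_ge0.
have wE : a + d * (l * u + (1 - l) * v)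
          = l * (a + d * u) + (1 - l) * (a + d * v) by ring.
have w0 : 0 < a + d * (l * u + (1 - l) * v).
  by rewrite wE conv_gt0.
rewrite mulrDr (mulrCA d l) (mulrCA d (1 - l)) !mul_linear_over_sqrt// wE.
(* Used twice: as concavity of the term [sqrt w], and as the bound on [z = sqrt w] that
   [inv_ge_conv] requires for the term [- a / sqrt w]. *)
have S := sqrtr_concave (ltW wu) (ltW wv) l0 l1.
have I := inv_ge_conv (x := Num.sqrt (a + d * u)) (y := Num.sqrt (a + d * v)).
have {I} := I _ l; rewrite !sqrtr_gt0 => /(_ _ wu wv l0 l1 S).
move=> /(ler_wpM2l a0); lra.
Qed.

(** For [d = 0] the function is linear. Otherwise multiplying by [d ^+ 2 > 0] turns the claim into
    [- (k * d)] times the preceding concavity gap. *)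
Lemma linear_over_sqrt_conv_le a d k u v l : 0 <= a -> k * d <= 0 ->
    0 < a + d * u -> 0 < a + d * v -> 0 <= l -> l <= 1 ->
  k * linear_over_sqrt a d (l * u + (1 - l) * v)
    <= l * (k * linear_over_sqrt a d u) + (1 - l) * (k * linear_over_sqrt a d v).
Proof.
move=> a0 kd wu wv l0 l1.
have := mul_linear_over_sqrt_concave a0 wu wv l0 l1.
have [->|d0] := eqVneq d 0.
  move=> _; rewrite /linear_over_sqrt !mul0r addr0 le_eqVlt; apply/orP; left.
  by apply/eqP; ring.
set X := linear_over_sqrt _ _ (_ + _); set Y := linear_over_sqrt _ _ u.
set Z := linear_over_sqrt _ _ v; rewrite -subr_ge0 => H.
rewrite -subr_ge0 -(@pmulr_rge0 _ (d ^+ 2)) ?exprn_even_gt0//=.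
have -> : d ^+ 2 * (l * (k * Y) + (1 - l) * (k * Z) - k * X)
   = - (k * d) * (d * X - d * (l * Y + (1 - l) * Z)) by ring.
by rewrite mulr_ge0// oppr_ge0.
Qed.

(** Cross-multiplying and squaring leaves a difference with the factor [v - u]; the cofactor
    [a * v + u * (a + d * v)] is positive for either sign of [d]. *)
Lemma linear_over_sqrt_lt a d u v : 0 < a -> 0 <= u -> u < v ->
  0 < a + d * u -> 0 < a + d * v ->
  linear_over_sqrt a d u < linear_over_sqrt a d v.
Proof.
move=> a0 u0 uv wu wv; have v0 := le_lt_trans u0 uv.
rewrite /linear_over_sqrt ltr_pdivrMr ?sqrtr_gt0// mulrAC.
rewrite ltr_pdivlMr ?sqrtr_gt0//.
rewrite -(@ltr_pXn2r _ 2) ?nnegrE ?mulr_ge0 ?sqrtr_ge0 ?(ltW v0)//.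
rewrite !exprMn !sqr_sqrtr ?(ltW wu) ?(ltW wv)// -subr_gt0.
have -> : v ^+ 2 * (a + d * u) - u ^+ 2 * (a + d * v)
   = (v - u) * (a * v + u * (a + d * v)) by ring.
by rewrite mulr_gt0 ?subr_gt0// ltr_wpDr ?mulr_gt0 ?mulr_ge0// ltW.
Qed.

(** * Transport to an interval along [x |-> e * x + p] *)

Section affine_reparametrization.
Variables (lo hi k a d e p : R) (f : R -> R).
Hypothesis a_gt0 : 0 < a.
Hypothesis u_ge0 : forall x, lo <= x <= hi -> 0 <= e * x + p.
Hypothesis w_gt0 : forall x, lo <= x <= hi -> 0 < a + d * (e * x + p).
Hypothesis fE : forall x, lo <= x <= hi ->
  f x = k * linear_over_sqrt a d (e * x + p).

Lemma linear_over_sqrt_convex : k * d <= 0 -> convex_on `[lo, hi] f.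
Proof.
move=> kd l x y; rewrite !inE /= !in_itv /= => xI yI.
have l0 : 0 <= l%:num by [].
have l1 : l%:num <= 1 by [].
(* Unfolds the abstract convex combination into plain arithmetic. *)
change (f (l%:num * x + (1 - l%:num) * y)
  <= l%:num * f x + (1 - l%:num) * f y).
have zI : lo <= l%:num * x + (1 - l%:num) * y <= hi.
  by move: (l%:num) l0 l1 xI yI => q *; apply/andP; split; nra.
rewrite !fE//.
have -> : e * (l%:num * x + (1 - l%:num) * y) + p
  = l%:num * (e * x + p) + (1 - l%:num) * (e * y + p) by ring.
by apply: linear_over_sqrt_conv_le; rewrite ?(ltW a_gt0)// w_gt0.
Qed.

(** [k] and [e] have the same sign; if both are negative, the two order reversals cancel. *)
Lemma linear_over_sqrt_incr : 0 < k * e -> strictly_increasing_on `[lo, hi] f.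
Proof.
move=> ke x y; rewrite !inE /= !in_itv /= => xI yI xy; rewrite !fE//.
have [k0|k0|k0] := ltgtP k 0; last by move: ke; rewrite k0 mul0r ltxx.
- have e0 : e < 0 by rewrite -(nmulr_rgt0 _ k0).
  rewrite ltr_nM2l//; apply: linear_over_sqrt_lt; rewrite ?u_ge0 ?w_gt0//.
  by rewrite ltrD2r ltr_nM2l.
- have e0 : 0 < e by rewrite -(pmulr_rgt0 _ k0).
  rewrite ltr_pM2l//; apply: linear_over_sqrt_lt; rewrite ?u_ge0 ?w_gt0//.
  by rewrite ltrD2r ltr_pM2l.
Qed.

End affine_reparametrization.

(** The convex case applied to [\- f], with [k] negated. *)
Lemma linear_over_sqrt_concave lo hi k a d e p f : 0 < a ->
  (forall x, lo <= x <= hi -> 0 < a + d * (e * x + p)) ->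
  (forall x, lo <= x <= hi -> f x = k * linear_over_sqrt a d (e * x + p)) ->
  0 <= k * d -> concave_on `[lo, hi] f.
Proof.
move=> a0 w0 fE kd.
apply: (@linear_over_sqrt_convex lo hi (- k) a d e p) => //; last first.
  by rewrite mulNr oppr_le0.
by move=> x xI; rewrite /= fE// mulNr.
Qed.

Lemma linear_over_sqrt_decr lo hi k a d e p f : 0 < a ->
  (forall x, lo <= x <= hi -> 0 <= e * x + p) ->
  (forall x, lo <= x <= hi -> 0 < a + d * (e * x + p)) ->
  (forall x, lo <= x <= hi -> f x = k * linear_over_sqrt a d (e * x + p)) ->
  k * e < 0 -> strictly_decreasing_on `[lo, hi] f.
Proof.
move=> a0 u0 w0 fE ke x y xI yI xy; rewrite -ltrN2.
apply: (@linear_over_sqrt_incr lo hi (- k) a d e p (\- f)) => //; last first.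
  by rewrite mulNr oppr_gt0.
by move=> z zI; rewrite /= fE// mulNr.
Qed.

End linear_over_sqrt.

(** * Restriction to subsets, and sets with at most one point *)

Section restriction.
Variable R : realType.
Implicit Types (D E : set R) (f : R -> R).

Lemma convex_onW D E f : D `<=` E -> convex_on E f -> convex_on D f.
Proof.
move=> DE cf t x y; rewrite !inE => /DE xE /DE yE.
by apply: cf; rewrite inE.
Qed.

Lemma concave_onW D E f : D `<=` E -> concave_on E f -> concave_on D f.
Proof. exact: convex_onW. Qed.

Lemma strictly_increasing_onW D E f : D `<=` E ->
  strictly_increasing_on E f -> strictly_increasing_on D f.
Proof.
move=> DE cf x y; rewrite !inE => /DE xE /DE yE.
by apply: cf; rewrite inE.
Qed.

Lemma strictly_decreasing_onW D E f : D `<=` E ->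
  strictly_decreasing_on E f -> strictly_decreasing_on D f.
Proof.
move=> DE cf x y; rewrite !inE => /DE xE /DE yE.
by apply: cf; rewrite inE.
Qed.

(** Serves the case [h = T / 2], where [tau T h] is a single point. *)
Lemma convex_on_subsingleton D f : is_subset1 D -> convex_on D f.
Proof.
move=> D1 t x y; rewrite !inE => xD yD.
by rewrite (D1 _ _ xD yD) !convmm.
Qed.

Lemma concave_on_subsingleton D f : is_subset1 D -> concave_on D f.
Proof. exact: convex_on_subsingleton. Qed.

End restriction.

(** * Closed forms of [m], [s] and [Lambda], and continuity *)

Definition rate_change (R : realType) (mu1 mu2 : R) : R := 1 / mu2 - 1 / mu1.

Lemma rate_change_neq0 (R : realType) (mu1 mu2 : R) :
  mu1 <> mu2 -> rate_change mu1 mu2 != 0.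
Proof.
by move=> /eqP; rewrite subr_eq0 !div1r (inj_eq invr_inj) eq_sym.
Qed.

(** The constant in [Var N_t ~ t sigma^2 / mu^3] for a renewal process whose waiting times have mean
    [mu] and variance [sigma^2]. *)
Definition renewal_variance (R : realType) (mu sigma : R) : R :=
  sigma ^+ 2 / mu ^+ 3.

Section standardized_drift.
Variables (R : realType) (h c mu1 mu2 sigma1 sigma2 : R) (n : nat).
Implicit Types t x y : R.
Hypothesis h_gt0 : 0 < h.
Hypotheses (mu1_gt0 : 0 < mu1) (mu2_gt0 : 0 < mu2).
Hypotheses (sigma1_gt0 : 0 < sigma1 ^+ 2) (sigma2_gt0 : 0 < sigma2 ^+ 2).

Local Notation jump := (rate_change mu1 mu2).
Local Notation var1 := (renewal_variance mu1 sigma1).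
Local Notation var2 := (renewal_variance mu2 sigma2).
Local Notation m := (m_fun h c mu1 mu2).
Local Notation s := (s_fun h c mu1 mu2 sigma1 sigma2).
Local Notation Lambda := (Lambda_fun h c mu1 mu2 sigma1 sigma2).

Let var1_gt0 : 0 < var1. Proof. exact: divr_gt0 sigma1_gt0 (exprn_gt0 3 mu1_gt0). Qed.
Let var2_gt0 : 0 < var2. Proof. exact: divr_gt0 sigma2_gt0 (exprn_gt0 3 mu2_gt0). Qed.

(** The central branch of [s2_fun] at [n = 1], taken as one affine function without case
    distinction. *)
Definition unit_var (t : R) : R := (t + h - c) * var2 + (c - (t - h)) * var1.

(** Both coefficients are nonnegative, and the one selected by the side of [c] on which [t] lies is
    at least [h]. *)
Lemma unit_var_gt0 t : c - h <= t <= c + h -> 0 < unit_var t.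
Proof.
move=> /andP[t1 t2]; have h0 := h_gt0.
have v1 := var1_gt0; have v2 := var2_gt0.
have u1 : 0 <= t + h - c by lra.
have u2 : 0 <= c - (t - h) by lra.
rewrite /unit_var; have [tc|tc] := leP t c.
  by apply: ltr_wpDl; [exact: mulr_ge0 u1 (ltW v2) | apply: mulr_gt0 => //; lra].
by apply: ltr_wpDr; [exact: mulr_ge0 u2 (ltW v1) | apply: mulr_gt0 => //; lra].
Qed.

Lemma s_funE t : c - h <= t <= c + h ->
  s n t = Num.sqrt n%:R * Num.sqrt (unit_var t).
Proof.
move=> tI; rewrite /s_fun /s2_fun ltNge; case/andP: (tI) => -> t2 /=.
rewrite ler_distl tI -sqrtrM// /unit_var /renewal_variance.
by rewrite !mulrA.
Qed.

Lemma m_funE t : c - h <= t <= c + h -> m n t = n%:R * jump * (h - `|t - c|).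
Proof. by move=> tI; rewrite /m_fun ler_distl tI. Qed.

(** [m] carries the factor [n] and [s] the factor [sqrt n]. What remains beside [sqrt n] is
    independent of [n], which later yields the exact order in [n]. *)
Lemma Lambda_funE t : c - h <= t <= c + h ->
  Lambda n t
    = Num.sqrt n%:R * (jump * (h - `|t - c|) / Num.sqrt (unit_var t)).
Proof.
move=> tI; rewrite /Lambda_fun m_funE// s_funE//.
(* At [n = 0] both sides are zero, the quotient by the convention [0 / 0 = 0]. *)
have [->|n0] := eqVneq n 0%N; first by rewrite sqrtr0 !mul0r.
have sn0 : 0 < Num.sqrt (n%:R : R) by rewrite sqrtr_gt0 ltr0n lt0n.
have su0 : 0 < Num.sqrt (unit_var t) by rewrite sqrtr_gt0 unit_var_gt0.
move: sn0 (sqr_sqrtr (ler0n R n)); set q := Num.sqrt n%:R => q0 <-; field.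
by rewrite !gt_eqF.
Qed.

(** The only point here at which [m_fun] takes its first branch is [c - h], where the factor
    [h - |t - c|] vanishes. *)
Lemma Lambda_fun_eq0 t : t \notin `]c - h, c + h] -> Lambda n t = 0.
Proof.
rewrite in_itv /= => tI; rewrite /Lambda_fun /m_fun ler_distl.
case: ifPn; last by rewrite mul0r.
move=> /andP[t1 t2]; move: tI; rewrite t2 andbT -leNgt => t3.
have -> : t = c - h by apply/eqP; rewrite eq_le t1 t3.
have -> : c - h - c = - h by ring.
by rewrite normrN ger0_norm ?(ltW h_gt0)// subrr mulr0 mul0r.
Qed.

Let clamp (t : R) : R := Num.max (c - h) (Num.min (c + h) t).

Let clampI t : c - h <= clamp t <= c + h.
Proof.
have h0 := h_gt0.
by rewrite /clamp le_max ge_max lexx ge_min lexx /=; lra.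
Qed.

(* Outside of [c - h, c + h] both sides vanish, so s may be frozen there at its
   endpoint values; the right-hand side has no case distinction. *)
Lemma Lambda_fun_clampE t :
  Lambda n t = Num.sqrt n%:R *
    (jump * (h - `|clamp t - c|) / Num.sqrt (unit_var (clamp t))).
Proof.
have h0 := h_gt0; have tcI := clampI t.
have [tI|tI] := boolP (c - h <= t <= c + h).
  have -> : clamp t = t by case/andP: tI => t1 t2; rewrite /clamp (min_r t2) max_r.
  exact: Lambda_funE.
rewrite Lambda_fun_eq0; last first.
  by apply: contra tI; rewrite in_itv /= => /andP[/ltW -> ->].
suff -> : `|clamp t - c| = h by rewrite subrr mulr0 mul0r mulr0.
rewrite /clamp; move: tI; rewrite negb_and -!ltNge => /orP[t1|t1].
  rewrite min_r ?max_l ?(ltW t1)//; last lra.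
  by have -> : c - h - c = - h by [ring]; rewrite normrN gtr0_norm.
rewrite min_l ?max_r ?(ltW t1)//; last lra.
by have -> : c + h - c = h by [ring]; rewrite gtr0_norm.
Qed.

Lemma Lambda_fun_continuous : continuous (Lambda n).
Proof.
have -> : Lambda n = fun t => Num.sqrt n%:R *
    (jump * (h - `|clamp t - c|) / Num.sqrt (unit_var (clamp t))).
  by apply/funext => t; exact: Lambda_fun_clampE.
have clampC : continuous (clamp : R -> R).
  move=> t.
  apply: (@continuous_max R R (fun=> c - h) (fun t => Num.min (c + h) t)).
    exact: cst_continuous.
  apply: (@continuous_min R R (fun=> c + h) id); first exact: cst_continuous.
  exact: cvg_id.
move=> t; apply: cvgM; first exact: cvg_cst.
apply: cvgM.
  apply: cvgM; first exact: cvg_cst.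
  apply: cvgB; first exact: cvg_cst.
  by apply: cvg_norm; apply: cvgB; [exact: clampC | exact: cvg_cst].
(* Clamped points stay in [[c - h, c + h]], so the denominator is never zero. *)
apply: cvgV; first by rewrite gt_eqF// sqrtr_gt0 unit_var_gt0.
apply: (@continuous_comp _ _ _ (unit_var \o clamp) Num.sqrt); last first.
  exact: sqrt_continuous.
rewrite /unit_var /=.
apply: cvgD; apply: cvgM; try exact: cvg_cst.
  apply: cvgB; last exact: cvg_cst.
  by apply: cvgD; [exact: clampC | exact: cvg_cst].
apply: cvgB; first exact: cvg_cst.
by apply: cvgB; [exact: clampC | exact: cvg_cst].
Qed.

(** * [Lambda] as the model function on each half *)

Let left_w_gt0 x : c - h <= x <= c ->
  0 < 2 * h * var1 + (var2 - var1) * (1 * x + (h - c)).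
Proof.
have h0 := h_gt0.
move=> xI; suff -> : 2 * h * var1 + (var2 - var1) * (1 * x + (h - c)) = unit_var x.
  by apply: unit_var_gt0; lra.
by rewrite /unit_var; ring.
Qed.

(** Here [u = x - (c - h)] equals [h - |x - c|], and [unit_var] is [2 * h * var1] at [u = 0] with
    slope [var2 - var1] in [u]. *)
Let left_LambdaE x : c - h <= x <= c -> Lambda n x = Num.sqrt n%:R * jump *
  linear_over_sqrt (2 * h * var1) (var2 - var1) (1 * x + (h - c)).
Proof.
have h0 := h_gt0.
move=> xI; rewrite Lambda_funE; last by lra.
rewrite ler0_norm; last by lra.
rewrite /linear_over_sqrt -!mulrA; congr (_ * (_ * (_ / Num.sqrt _))).
  by ring.
by rewrite /unit_var; ring.
Qed.

Let right_w_gt0 x : c <= x <= c + h ->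
  0 < 2 * h * var2 + (var1 - var2) * (-1 * x + (c + h)).
Proof.
have h0 := h_gt0.
move=> xI; suff -> : 2 * h * var2 + (var1 - var2) * (-1 * x + (c + h)) = unit_var x.
  by apply: unit_var_gt0; lra.
by rewrite /unit_var; ring.
Qed.

(** Mirror image: [u = c + h - x], with [var1] and [var2] exchanged. *)
Let right_LambdaE x : c <= x <= c + h -> Lambda n x = Num.sqrt n%:R * jump *
  linear_over_sqrt (2 * h * var2) (var1 - var2) (-1 * x + (c + h)).
Proof.
have h0 := h_gt0.
move=> xI; rewrite Lambda_funE; last by lra.
rewrite ger0_norm; last by lra.
rewrite /linear_over_sqrt -!mulrA; congr (_ * (_ * (_ / Num.sqrt _))).
  by ring.
by rewrite /unit_var; ring.
Qed.

Let left_a_gt0 : 0 < 2 * h * var1. Proof. by apply: mulr_gt0 => //; apply: mulr_gt0. Qed.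
Let right_a_gt0 : 0 < 2 * h * var2. Proof. by apply: mulr_gt0 => //; apply: mulr_gt0. Qed.
Let left_u_ge0 x : c - h <= x <= c -> 0 <= 1 * x + (h - c). Proof. by move=> xI; lra. Qed.
Let right_u_ge0 x : c <= x <= c + h -> 0 <= -1 * x + (c + h). Proof. by move=> xI; lra. Qed.

Lemma Lambda_left_convex : jump * (var2 - var1) <= 0 ->
  convex_on `[c - h, c] (Lambda n).
Proof.
move=> kd; apply: linear_over_sqrt_convex left_a_gt0 left_w_gt0 left_LambdaE _.
by rewrite -mulrA mulr_ge0_le0.
Qed.

Lemma Lambda_left_concave : 0 <= jump * (var2 - var1) ->
  concave_on `[c - h, c] (Lambda n).
Proof.
move=> kd; apply: linear_over_sqrt_concave left_a_gt0 left_w_gt0 left_LambdaE _.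
by rewrite -mulrA mulr_ge0.
Qed.

(** The reflection negates [d] but keeps [jump], so the sign condition is opposite to that on the
    left half. *)
Lemma Lambda_right_convex : 0 <= jump * (var2 - var1) ->
  convex_on `[c, c + h] (Lambda n).
Proof.
move=> kd; apply: linear_over_sqrt_convex right_a_gt0 right_w_gt0 right_LambdaE _.
by rewrite -mulrA mulr_ge0_le0// -[_ - _]opprB mulrN oppr_le0.
Qed.

Lemma Lambda_right_concave : jump * (var2 - var1) <= 0 ->
  concave_on `[c, c + h] (Lambda n).
Proof.
move=> kd; apply: linear_over_sqrt_concave right_a_gt0 right_w_gt0 right_LambdaE _.
by rewrite -mulrA mulr_ge0// -[_ - _]opprB mulrN oppr_ge0.
Qed.

(** * Strict monotonicity on each half *)

Hypothesis n_gt0 : (0 < n)%N.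

Let sqrtn_gt0 : 0 < Num.sqrt (n%:R : R).
Proof. by rewrite sqrtr_gt0 ltr0n. Qed.

Lemma Lambda_left_incr : 0 < jump ->
  strictly_increasing_on `[c - h, c] (Lambda n).
Proof.
move=> k0; apply: linear_over_sqrt_incr
  left_a_gt0 left_u_ge0 left_w_gt0 left_LambdaE _.
by rewrite mulr1 mulr_gt0.
Qed.

Lemma Lambda_left_decr : jump < 0 ->
  strictly_decreasing_on `[c - h, c] (Lambda n).
Proof.
move=> k0; apply: linear_over_sqrt_decr
  left_a_gt0 left_u_ge0 left_w_gt0 left_LambdaE _.
by rewrite mulr1 pmulr_rlt0.
Qed.

Lemma Lambda_right_decr : 0 < jump ->
  strictly_decreasing_on `[c, c + h] (Lambda n).
Proof.
move=> k0; apply: linear_over_sqrt_decr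
  right_a_gt0 right_u_ge0 right_w_gt0 right_LambdaE _.
by rewrite mulrN1 oppr_lt0 mulr_gt0.
Qed.

Lemma Lambda_right_incr : jump < 0 ->
  strictly_increasing_on `[c, c + h] (Lambda n).
Proof.
move=> k0; apply: linear_over_sqrt_incr
  right_a_gt0 right_u_ge0 right_w_gt0 right_LambdaE _.
by rewrite mulrN1 oppr_gt0 pmulr_rlt0.
Qed.

(** * Signs of [jump] and [var2 - var1] from the hypotheses on [m] and [s] *)

Variable T : R.
Hypotheses (c_gt0 : 0 < c) (c_ltT : c < T) (h_le : h <= T / 2).

(** The point of [tau T h] nearest to [c] works: if it is an endpoint, its distance to [c] is below
    [h] because [0 < c < T]. *)
Let point_in_tau : exists2 t, t \in tau T h & `|t - c| < h.
Proof.
have h0 := h_gt0; have c0' := c_gt0; have cltT' := c_ltT; have hT' := h_le.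
have [hc|hc] := lerP c h.
  by exists h; rewrite ?inE /tau /= ?in_itv /= ?ltr_distl; lra.
have [cT|cT] := lerP c (T - h).
  by exists c; rewrite ?subrr ?normr0// inE /tau /= in_itv /=; lra.
by exists (T - h); rewrite ?inE /tau /= ?in_itv /= ?ltr_distl; lra.
Qed.

(** At a point with [|t - c| < h] the tent factor is positive, so [m] has the sign of [jump]. *)
Lemma m_fun_ge0_jump : (forall t, t \in tau T h -> 0 <= m n t) -> 0 <= jump.
Proof.
move=> m0; have [t tt ltc] := point_in_tau; have := m0 t tt.
rewrite /m_fun (ltW ltc) pmulr_lge0 ?subr_gt0// pmulr_rge0// ltr0n//.
Qed.

Lemma m_fun_le0_jump : (forall t, t \in tau T h -> m n t <= 0) -> jump <= 0.
Proof.
move=> m0; have [t tt ltc] := point_in_tau; have := m0 t tt.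
rewrite /m_fun (ltW ltc) pmulr_lle0 ?subr_gt0// pmulr_rle0// ltr0n//.
Qed.

(** [unit_var] is affine with slope [var2 - var1], and the square root preserves order. *)
Let s_fun_le x y : c - h <= x <= c + h -> c - h <= y <= c + h ->
  (s n x <= s n y) = (0 <= (y - x) * (var2 - var1)).
Proof.
move=> xI yI; have ux := unit_var_gt0 xI; have uy := unit_var_gt0 yI.
rewrite !s_funE// ler_pM2l// ler_sqrt ?(ltW uy)// -subr_ge0; congr (0 <= _).
by rewrite /unit_var; ring.
Qed.

Let two_points_in_tau : h < T - h -> exists x y,
  [/\ x \in tau T h, y \in tau T h, x < y,
      c - h <= x <= c + h & c - h <= y <= c + h].
Proof.
have h0 := h_gt0; have c0' := c_gt0; have cltT' := c_ltT.
(* The two ends of the intersection of [tau T h] with [[c - h, c + h]]. *)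
move=> hT; exists (Num.max h (c - h)), (Num.min (T - h) (c + h)).
rewrite !inE /tau /= !in_itv /= !(le_max, ge_max, le_min, ge_min) lt_min !gt_max.
by split; lra.
Qed.

(** [h < T - h] supplies two distinct points to compare; on a single point monotonicity of [s]
    carries no information. *)
Lemma s_fun_incr_var : h < T - h -> increasing_on (tau T h) (s n) -> var1 <= var2.
Proof.
move=> /two_points_in_tau[x [y [xt yt xy xI yI]]] s_incr.
have := s_incr x y xt yt (ltW xy).
by rewrite s_fun_le// pmulr_rge0 ?subr_gt0// subr_ge0.
Qed.

Lemma s_fun_decr_var : h < T - h -> decreasing_on (tau T h) (s n) -> var2 <= var1.
Proof.
move=> /two_points_in_tau[x [y [xt yt xy xI yI]]] s_decr.
have := s_decr x y xt yt (ltW xy).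
by rewrite s_fun_le// nmulr_rge0 ?subr_lt0// subr_le0.
Qed.

End standardized_drift.

(** * Assembly of the sign cases, and the order in [n] *)

Theorem lemma2p6 (R : realType) (T h c mu1 mu2 sigma1 sigma2 : R)
    (T_gt0 : 0 < T) (h_gt0 : 0 < h) (h_le : h <= T / 2)
    (c_gt0 : 0 < c) (c_ltT : c < T)
    (mu1_gt0 : 0 < mu1) (mu2_gt0 : 0 < mu2)
    (sigma1_gt0 : 0 < sigma1 ^+ 2) (sigma2_gt0 : 0 < sigma2 ^+ 2) :
  let m := m_fun h c mu1 mu2 in
  let s := s_fun h c mu1 mu2 sigma1 sigma2 in
  let Lambda := Lambda_fun h c mu1 mu2 sigma1 sigma2 in
  let tau_h := tau T h in
  let left_itv := `[c - h, c] `&` tau_h in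
  let right_itv := `]c, c + h] `&` tau_h in
  (forall n : nat, (0 < n)%N ->
    [/\ {within tau_h, continuous (Lambda n)},
        (forall t, t \in tau_h `\` `]c - h, c + h] -> Lambda n t = 0),
        (mu1 = mu2 ->
          forall t, t \in `]c - h, c + h] `&` tau_h -> Lambda n t = 0) &
        mu1 <> mu2 ->
        [/\ ((forall t, t \in tau_h -> 0 <= m n t) ->
              increasing_on tau_h (s n) ->
              [/\ concave_on left_itv (Lambda n),
                  strictly_increasing_on left_itv (Lambda n),
                  convex_on right_itv (Lambda n) &
                  strictly_decreasing_on right_itv (Lambda n)]),
            ((forall t, t \in tau_h -> 0 <= m n t) ->
              decreasing_on tau_h (s n) ->
              [/\ convex_on left_itv (Lambda n),
                  strictly_increasing_on left_itv (Lambda n),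
                  concave_on right_itv (Lambda n) &
                  strictly_decreasing_on right_itv (Lambda n)]),
            ((forall t, t \in tau_h -> m n t <= 0) ->
              increasing_on tau_h (s n) ->
              [/\ convex_on left_itv (Lambda n),
                  strictly_decreasing_on left_itv (Lambda n),
                  concave_on right_itv (Lambda n) &
                  strictly_increasing_on right_itv (Lambda n)]) &
            ((forall t, t \in tau_h -> m n t <= 0) ->
              decreasing_on tau_h (s n) ->
              [/\ concave_on left_itv (Lambda n),
                  strictly_decreasing_on left_itv (Lambda n),
                  convex_on right_itv (Lambda n) &
                  strictly_increasing_on right_itv (Lambda n)])]])
  /\ (mu1 <> mu2 ->
      forall t, t \in tau_h -> `|t - c| < h ->
        (fun n : nat => `|Lambda n t| : R^o) =Theta_\oo
        (fun n : nat => Num.sqrt (n%:R * h) : R^o)).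
Proof.
move=> m s Lambda tau_h left_itv right_itv.
have left_sub : left_itv `<=` `[c - h, c] by move=> t [].
have right_sub : right_itv `<=` `[c, c + h].
  by move=> t []; rewrite /= !in_itv /= => /andP[/ltW -> ->].
split=> [n n_gt0|mu_neq t _ tc].
  split.
  - by apply: continuous_subspaceT; exact: Lambda_fun_continuous.
  - move=> t; rewrite inE => -[_ tI]; apply: Lambda_fun_eq0 => //.
    exact/negP.
  - move=> mu12 t _; rewrite /Lambda /Lambda_fun /m_fun mu12.
    by rewrite subrr mulr0 mul0r if_same mul0r.
  move=> mu_neq.
  set jump := rate_change mu1 mu2.
  have jump_neq0 : jump != 0 by exact: rate_change_neq0.
  set var1 := renewal_variance mu1 sigma1; set var2 := renewal_variance mu2 sigma2.
  (* The sign of [m] gives only a weak inequality; [mu1 <> mu2] makes it strict. *)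
  have jump_gt0 : (forall t, t \in tau_h -> 0 <= m n t) -> 0 < jump.
    move=> m0; rewrite lt_def jump_neq0.
    by rewrite (m_fun_ge0_jump h_gt0 n_gt0 c_gt0 c_ltT h_le m0).
  have jump_lt0 : (forall t, t \in tau_h -> m n t <= 0) -> jump < 0.
    move=> m0; rewrite lt_neqAle jump_neq0.
    by rewrite (m_fun_le0_jump h_gt0 n_gt0 c_gt0 c_ltT h_le m0).
  have left_incr (j0 : 0 < jump) : strictly_increasing_on left_itv (Lambda n).
    by apply: strictly_increasing_onW left_sub _; exact: Lambda_left_incr.
  have left_decr (j0 : jump < 0) : strictly_decreasing_on left_itv (Lambda n).
    by apply: strictly_decreasing_onW left_sub _; exact: Lambda_left_decr.
  have right_incr (j0 : jump < 0) : strictly_increasing_on right_itv (Lambda n).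
    by apply: strictly_increasing_onW right_sub _; exact: Lambda_right_incr.
  have right_decr (j0 : 0 < jump) : strictly_decreasing_on right_itv (Lambda n).
    by apply: strictly_decreasing_onW right_sub _; exact: Lambda_right_decr.
  (* If [T - h <= h], then [tau_h] has at most one point: [s] reveals nothing about the variances,
     but convexity and concavity are trivial. *)
  have [hT|Th] := ltP h (T - h); last first.
    have tau1 : is_subset1 tau_h.
      move=> x y; rewrite /tau_h /tau /= !in_itv /=; lra.
    have left1 : is_subset1 left_itv by move=> x y [_ xt] [_ yt]; exact: tau1.
    have right1 : is_subset1 right_itv by move=> x y [_ xt] [_ yt]; exact: tau1.
    have left_convex f := @convex_on_subsingleton R _ f left1.
    have left_concave f := @concave_on_subsingleton R _ f left1.
    have right_convex f := @convex_on_subsingleton R _ f right1.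
    have right_concave f := @concave_on_subsingleton R _ f right1.
    split=> [/jump_gt0 j0|/jump_gt0 j0|/jump_lt0 j0|/jump_lt0 j0] _; split;
    by [exact: left_convex|exact: left_concave|exact: right_convex
       |exact: right_concave|auto].
  have left_convex (jv : jump * (var2 - var1) <= 0) : convex_on left_itv (Lambda n).
    by apply: convex_onW left_sub _; exact: Lambda_left_convex.
  have left_concave (jv : 0 <= jump * (var2 - var1)) : concave_on left_itv (Lambda n).
    by apply: concave_onW left_sub _; exact: Lambda_left_concave.
  have right_convex (jv : 0 <= jump * (var2 - var1)) : convex_on right_itv (Lambda n).
    by apply: convex_onW right_sub _; exact: Lambda_right_convex.
  have right_concave (jv : jump * (var2 - var1) <= 0) : concave_on right_itv (Lambda n).
    by apply: concave_onW right_sub _; exact: Lambda_right_concave.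
  have s_incr : increasing_on tau_h (s n) -> 0 <= var2 - var1.
    by rewrite subr_ge0; exact: s_fun_incr_var.
  have s_decr : decreasing_on tau_h (s n) -> var2 - var1 <= 0.
    by rewrite subr_le0; exact: s_fun_decr_var.
  split=> [/jump_gt0 j0 /s_incr dv|/jump_gt0 j0 /s_decr dv
          |/jump_lt0 j0 /s_incr dv|/jump_lt0 j0 /s_decr dv].
  - have jv : 0 <= jump * (var2 - var1) by rewrite mulr_ge0 ?(ltW j0).
    by split; auto.
  - have jv : jump * (var2 - var1) <= 0 by rewrite mulr_ge0_le0 ?(ltW j0).
    by split; auto.
  - have jv : jump * (var2 - var1) <= 0 by rewrite mulr_le0_ge0 ?(ltW j0).
    by split; auto.
  - have jv : 0 <= jump * (var2 - var1) by rewrite mulr_le0 ?(ltW j0).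
    by split; auto.
have tI : c - h <= t <= c + h by rewrite -ler_distl ltW.
pose K := rate_change mu1 mu2 * (h - `|t - c|)
  / Num.sqrt (unit_var h c mu1 mu2 sigma1 sigma2 t).
have u_gt0 := unit_var_gt0 h_gt0 mu1_gt0 mu2_gt0 sigma1_gt0 sigma2_gt0 tI.
have K_gt0 : 0 < `|K|.
  rewrite normr_gt0 mulf_neq0//; last by rewrite invr_eq0 gt_eqF// sqrtr_gt0.
  by rewrite mulf_neq0 ?rate_change_neq0// gt_eqF// subr_gt0.
have sh_gt0 : 0 < Num.sqrt h by rewrite sqrtr_gt0.
(* [K] is the factor of [Lambda] free of [n]; dividing by [sqrt h] makes [|Lambda n t|] exactly
   [q * sqrt (n * h)]. *)
pose q := `|K| / Num.sqrt h; have q_gt0 : 0 < q by rewrite divr_gt0.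
have LambdaE n : `|Lambda n t| = q * Num.sqrt (n%:R * h).
  rewrite /Lambda Lambda_funE// normrM (ger0_norm (sqrtr_ge0 _)) sqrtrM//.
  by rewrite -/K /q; field; rewrite gt_eqF.
rewrite eqThetaE qualifE; apply/asboolP.
(* By this equality, [q] is both the lower and the upper constant, for every [n]. *)
exists (q, q); first by rewrite /= q_gt0.
by apply: nearW => n /=; rewrite LambdaE normrM (gtr0_norm q_gt0).
Qed.
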